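(* Let $1\to N\to G\to\Gamma\to1$ be a short exact sequence of groups such that $\Gamma$ is locally cyclic. Then $\mathrm{cl}_G$ and $\mathrm{cl}_{G,N}$ coincide on $[G,N]$, i.e. $\mathrm{cl}_G(x)=\mathrm{cl}_{G,N}(x)$ for every $x\in[G,N]$.
   Context: A group is locally cyclic if every finitely generated subgroup of it is cyclic. $N$ is regarded as a normal subgroup of $G$. A mixed commutator is an element $[g,x]=gxg^{-1}x^{-1}$ with $g\in G$, $x\in N$; $[G,N]$ is the subgroup generated by mixed commutators, and for $x\in[G,N]$, $\mathrm{cl}_{G,N}(x)$ is the smallest integer $n\ge0$ such that $x$ is a product of $n$ mixed commutators. $\mathrm{cl}_G=\mathrm{cl}_{G,G}$ is the ordinary commutator length on $[G,G]$. *)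

(* Defs.v *)
From mathcomp Require Import all_boot.
From mathcomp Require Import boolp classical_sets.

Set Implicit Arguments.
Unset Strict Implicit.
Unset Printing Implicit Defensive.

Local Open Scope classical_set_scope.
Local Open Scope group_scope.

Section Subgroups.
Variable G : groupType.
Implicit Types A H N : set G.

Definition is_subgroup H : Prop := group_closed [in H].

Definition generated A : set G := smallest is_subgroup A.

Definition finitely_generated H : Prop :=
  exists s : seq G, H = generated [set` s].

Definition is_cyclic H : Prop := exists g : G, H = generated [set g].

(* The convention [g, x] = g x g^-1 x^-1 is not that of the library, where
   [~ g, x] = g^-1 x^-1 g x. *)
Definition mixed_commutator (g x : G) : G := g * x * g^-1 * x^-1.

Definition mixed_commutators N : set G :=
  [set y | exists g x : G, N x /\ y = mixed_commutator g x].

(* The subgroup [G, N]. *)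
Definition mixed_commutator_subgroup N : set G :=
  generated (mixed_commutators N).

Definition product_of_mixed_commutators N (n : nat) (x : G) : Prop :=
  exists s : seq G, [/\ size s = n,
    [set` s] `<=` mixed_commutators N & x = \prod_(y <- s) y].

Definition is_least (P : nat -> Prop) (n : nat) : Prop :=
  P n /\ forall m, P m -> (n <= m)%N.

(* cl_{G,N}; the default value 0 is only taken outside [G, N], see
   [mixed_commutator_lengthP]. *)
Definition mixed_commutator_length N (x : G) : nat :=
  xget 0%N [set n | is_least (product_of_mixed_commutators N ^~ x) n].

End Subgroups.

Definition commutator_length (G : groupType) (x : G) : nat :=
  mixed_commutator_length setT x.

Definition locally_cyclic (G : groupType) : Prop :=
  forall H : set G, is_subgroup H -> finitely_generated H -> is_cyclic H.

Definition short_exact (N G Q : groupType)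
    (i : UMagmaMorphism.type N G)
    (p : UMagmaMorphism.type G Q) : Prop :=
  [/\ injective i, range i = p @^-1` [set 1] & range p = setT].

Lemma mixed_commutatorsV (G : groupType) (N : set G) :
  (forall g x : G, N x -> N (g * x * g^-1)) ->
  forall y, mixed_commutators N y -> mixed_commutators N y^-1.
Proof.
move=> N_normal _ [g [x [Nx ->]]]; exists g^-1, (g * x * g^-1); split.
  exact: N_normal.
by rewrite /mixed_commutator !gnorm.
Qed.

Lemma mixed_commutator_lengthP (G : groupType) (N : set G) :
  (forall g x : G, N x -> N (g * x * g^-1)) ->
  forall x, mixed_commutator_subgroup N x ->
  is_least (product_of_mixed_commutators N ^~ x) (mixed_commutator_length N x).
Proof.
move=> N_normal x Gx.
have [n Pn] : exists n, product_of_mixed_commutators N n x.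
  apply: (Gx [set z | exists n, product_of_mixed_commutators N n z]); split.
    split; first by rewrite !inE; exists 0%N, [::]; split=> //; rewrite big_nil.
    move=> u v; rewrite !inE => -[_ [s [_ sN ->]]] [_ [t [_ tN ->]]].
    exists (size (s ++ [seq y^-1 | y <- rev t])), (s ++ [seq y^-1 | y <- rev t]).
    split=> //.
      move=> y /=; rewrite mem_cat => /orP[/sN//|/mapP[z]].
      by rewrite mem_rev => /tN /(mixed_commutatorsV N_normal) + ->.
    rewrite big_cat; congr (_ * _); rewrite big_map.
    elim: t {tN} => [|z t IH]; first by rewrite !big_nil invg1.
    by rewrite big_cons invgM IH rev_cons -cats1 big_cat big_seq1.
  move=> y Ny; exists 1%N, [:: y]; split=> //; last by rewrite big_seq1.
  by move=> z /=; rewrite inE => /eqP ->.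
have ex : exists n, `[< product_of_mixed_commutators N n x >].
  by exists n; apply/asboolP.
apply: (@xgetPex _ 0%N).
case: (ex_minnP ex) => m /asboolP Pm min_m; exists m; split=> // k Pk.
exact/min_m/asboolP.
Qed.

(* Main.v *)
Require Import Defs.
From mathcomp Require Import all_boot.
From mathcomp Require Import boolp classical_sets.

(** Every commutator of [G] is already a mixed commutator, so the two lengths
    count the same factors. Given [a] and [b], local cyclicity provides [t] in
    [Gamma] of which [p a] and [p b] are powers. Neither the replacement of [a]
    by a product of [a] with a power of [b], nor the rotation
    [a, b] = [a b a^-1, a^-1] changes the commutator, and on the exponents of
    [t] these moves run the Euclidean algorithm: they end with a second entry
    in the kernel of [p], that is, in [N]. *)

Local Open Scope classical_set_scope.
Local Open Scope group_scope.

Lemma is_subgroup_generated (G : groupType) (A : set G) :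
  is_subgroup (generated A).
Proof.
split; first by rewrite inE => H [[H1 _] _]; rewrite inE in H1.
move=> u v; rewrite !inE => Au Av H [sH AH].
have [_ /(_ u v)] := sH; rewrite !inE.
by apply; [apply: Au | apply: Av].
Qed.

Lemma generated_set1P (G : groupType) (t u : G) :
  generated [set t] u -> exists n, u = t ^+ n \/ u = t ^- n.
Proof.
pose P := [set u | exists n, u = t ^+ n \/ u = t ^- n].
apply: (@smallest_sub _ _ _ P); last by move=> _ ->; exists 1%N; left.
(* The mixed-sign cases of closure under division both reduce to this one. *)
have P_div m n : P (t ^+ m / t ^+ n).
  case/orP: (leq_total n m) => [le_nm | le_mn].
    by exists (m - n)%N; left; rewrite expgnFr.
  by exists (n - m)%N; right; rewrite expgnFr// invgF.
split; first by rewrite inE; exists 0%N; left.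
move=> u1 u2; rewrite !inE => -[m [] ->] [n [] ->]; rewrite ?invgK.
- exact: P_div.
- by rewrite -expgnDr; exists (m + n)%N; left.
- by rewrite -invgM -expgnDr; exists (n + m)%N; right.
- have -> : t ^- m * t ^+ n = t ^+ n / t ^+ m.
    exact/commute_sym/commuteV/commuteX2.
  exact: P_div.
Qed.

Lemma locally_cyclic_pair (G : groupType) (u v : G) :
  locally_cyclic G ->
  exists t, generated [set t] u /\ generated [set t] v.
Proof.
move=> /(_ (generated [set` [:: u; v]])) []; first exact: is_subgroup_generated.
  by exists [:: u; v].
move=> t gen_t; exists t; rewrite -gen_t.
by split; apply: sub_gen_smallest; rewrite /= !inE eqxx ?orbT.
Qed.

Lemma mixed_commutator_rotate (G : groupType) (a b : G) :
  mixed_commutator a b = mixed_commutator (a * b * a^-1) a^-1.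
Proof. by rewrite /mixed_commutator !gnorm. Qed.

(** Conjugation by [c] fixes [b], so [a * c] and [a] conjugate [b] alike. *)
Lemma mixed_commutatorMl (G : groupType) (a b c : G) :
  commute b c -> mixed_commutator (a * c) b = mixed_commutator a b.
Proof.
move=> bc; rewrite /mixed_commutator invgM -!mulgA (mulgA c b) -bc.
by rewrite -!mulgA (mulgA c) mulgV mul1g.
Qed.

Section Kernel.
Variables (G Q : groupType) (p : UMagmaMorphism.type G Q).

(* Only the sign of the second exponent has to be tracked: that of the first is
   absorbed by replacing [t] with its inverse. *)
Lemma mixed_commutator_euclid (t : Q) (m n : nat) (a b : G) :
  p a = t ^+ m -> p b = t ^+ n \/ p b = t ^- n ->
  mixed_commutators (p @^-1` [set 1]) (mixed_commutator a b).
Proof.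
elim/ltn_ind: n t m a b => n IHn t m a b pa pb.
have [n0 | n_gt0] := posnP n.
  by exists a, b; split=> //; case: pb => /= ->; rewrite n0 ?expg0 ?invg1.
(* Division step: [c] is the power of [b], with sign opposite to that of [p b], that reduces the
   exponent of [p a] modulo [n]. *)
have [c [bc pc]] : exists c, commute b c /\ p c = t ^- (m %/ n * n).
  case: pb => pb; [exists (b ^- (m %/ n)) | exists (b ^+ (m %/ n))].
    split; first exact/commuteV/commuteX.
    by rewrite gmulfV gmulfXn pb -expgnA mulnC.
  split; first exact: commuteX.
  by rewrite gmulfXn pb -expVgn -expgnA mulnC expVgn.
have pac : p (a * c) = t ^+ (m %% n).
  by rewrite gmulfM pa pc -expgnFr ?leq_divM// {1}(divn_eq m n) addKn.
rewrite -(mixed_commutatorMl _ _ _ _ bc) mixed_commutator_rotate.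
(* Powers of [t] commute, so this conjugation is invisible in [Q]. *)
have pacb : p (a * c * b * (a * c)^-1) = p b.
  rewrite gmulfM gmulfV gmulfM !pac.
  suff <- : commute (p b) (t ^+ (m %% n)) by rewrite mulgK.
  apply: commuteX; apply: commute_sym; case: pb => ->.
    exact: commuteX.
  exact/commuteV/commuteX.
have pacV : p (a * c)^-1 = t ^- (m %% n) by rewrite gmulfV pac.
have lt_mn := ltn_pmod m n_gt0.
(* After rotation the exponents are [n] up to sign and [- (m %% n)]; a negative first one is made
   positive by passing to [t^-1]. *)
case: pb => pb; first by apply: (IHn _ lt_mn t n); [rewrite pacb | right].
apply: (IHn _ lt_mn t^-1 n); first by rewrite pacb pb expVgn.
by left; rewrite pacV expVgn.
Qed.

Lemma mixed_commutators_ker :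
  locally_cyclic Q ->
  mixed_commutators (p @^-1` [set 1]) = mixed_commutators [set: G].
Proof.
move=> Q_lc; apply/seteqP; split=> [_ [a [b [_ ->]]] | _ [a [b [_ ->]]]].
  by exists a, b.
have [t [/generated_set1P[m pa] /generated_set1P[n pb]]] :=
  locally_cyclic_pair _ (p a) (p b) Q_lc.
case: pa => pa; first exact: (mixed_commutator_euclid t m n).
apply: (mixed_commutator_euclid t^-1 m n); first by rewrite expVgn.
by rewrite expVgn invgK; case: pb; [right | left].
Qed.

End Kernel.

Theorem theorem1p7 (N G Gamma : groupType)
    (i : UMagmaMorphism.type N G)
    (p : UMagmaMorphism.type G Gamma)
    (exact_ip : short_exact i p)
    (Gamma_lc : locally_cyclic Gamma)
    (x : G) (x_in : mixed_commutator_subgroup (range i) x) :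
  commutator_length x = mixed_commutator_length (range i) x.
Proof.
have [_ -> _] := exact_ip.
(* Both lengths depend on the subgroup only through its set of mixed commutators, so equality of
   these sets suffices. *)
rewrite /commutator_length /mixed_commutator_length.
by rewrite /product_of_mixed_commutators (mixed_commutators_ker _ _ p Gamma_lc).
Qed.
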